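(* Let $\dot S_n$ be the subgroup of $B_n$ generated by $s_1,\dots,s_{n-1}$. The presentation of every element $\pi\in\dot S_n$ by the generalized standard $OGS$ has the following form: 1. $\pi=\tau_{k_1}^{i_{k_1}}\cdot\tau_{k_2}^{i_{k_2}}\cdots\tau_{k_m}^{i_{k_m}}$, where $-k_j\le i_{k_j}\le k_j-1$ for every $1\le j\le m$, and $i_{k_1}<0$; 2. $\sum_{j=1}^m i_{k_j}=0$; 3. $0\le\sum_{j=r}^m i_{k_j}\le k_{r-1}$ for $2\le r\le m$. Here condition 3 is equivalent to: $-k_r\le\sum_{j=1}^r i_{k_j}\le 0$ for $1\le r\le m-1$.
   Context: $B_n$ is the group of signed permutations, i.e. the bijections $\pi$ of $\{\pm1,\dots,\pm n\}$ with $\pi(-i)=-\pi(i)$. It is a Coxeter group with generators $s_0,\dots,s_{n-1}$, where $s_0$ exchanges $1$ and $-1$, and for $1\le i\le n-1$, $s_i$ exchanges $i$ with $i+1$ and $-i$ with $-(i+1)$. Products are read from left to right: $(\pi_1\cdot\pi_2)(i)=\pi_2(\pi_1(i))$. For $1\le k\le n$, $\tau_k=s_0s_1\cdots s_{k-1}$. Every element of $B_n$ has a unique presentation $\tau_1^{i_1}\cdot\tau_2^{i_2}\cdots\tau_n^{i_n}$ with integers $-k\le i_k<k$, called its generalized standard $OGS$ presentation; omitting trivial factors it is written $\tau_{k_1}^{i_{k_1}}\cdots\tau_{k_m}^{i_{k_m}}$ with $1\le k_1<\dots<k_m\le n$ and all $i_{k_j}\ne 0$. *)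

(* Defs.v *)
From mathcomp Require Import all_boot all_order all_algebra all_fingroup.

Set Implicit Arguments.
Unset Strict Implicit.
Unset Printing Implicit Defensive.

Import GroupScope.

(* The set {±1, ..., ±n}: the pair (b, j) stands for j + 1 if b = false and for
   -(j + 1) if b = true (ordinals start at 0). *)
Definition spoint (n : nat) : finType := (bool * 'I_n)%type.

Definition sopp (n : nat) (x : spoint n) : spoint n := (~~ x.1, x.2).

(* Products in {perm T} are read from left to right: (p * q) x = q (p x). *)
Definition signed_perms (n : nat) : {set {perm spoint n}} :=
  [set p : {perm spoint n} | [forall x, p (sopp x) == sopp (p x)]].

Lemma signed_permsP n (p : {perm spoint n}) :
  reflect (forall x, p (sopp x) = sopp (p x)) (p \in signed_perms n).
Proof. by rewrite inE; exact: 'forall_eqP. Qed.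

Lemma signed_perms_group_set n : group_set (signed_perms n).
Proof.
apply/group_setP; split; first by apply/signed_permsP => x; rewrite !perm1.
move=> p q /signed_permsP Hp /signed_permsP Hq.
by apply/signed_permsP => x; rewrite !permM Hp Hq.
Qed.

Definition B (n : nat) : {group {perm spoint n}} := Group (signed_perms_group_set n).

(* For i > 0 the integers i and i + 1 are encoded by the ordinals i - 1
   (= ord_pred i) and i. *)
Definition cox (n : nat) (i : 'I_n) : {perm spoint n} :=
  if i == 0 :> nat then tperm (false, i) (true, i)
  else tperm (false, ord_pred i) (false, i) * tperm (true, ord_pred i) (true, i).

Lemma cox_in_B n (i : 'I_n) : cox i \in B n.
Proof.
have oppI : injective (@sopp n) by case=> b x [c y] /= [/negb_inj -> ->].
have oppT (a b x : spoint n) : sopp (tperm a b x) = tperm (sopp a) (sopp b) (sopp x).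
  exact: inj_tperm.
apply/signed_permsP => x; rewrite /cox; case: ifP => _.
  by rewrite oppT [in RHS]tpermC.
rewrite !permM !oppT -!permM /sopp /=; congr (fun_of_perm _ _).
by rewrite conjgC tpermJ !tpermD.
Qed.

(* tau n k is s_0 s_1 ... s_{k-1} when 1 <= k <= n; other values of k are not used. *)
Definition tau (n k : nat) : {perm spoint n} := \prod_(i < n | (i < k)%N) cox i.

Definition dotS (n : nat) : {group {perm spoint n}} :=
  <<[set cox i | i : 'I_n & (0 < i)%N]>>%G.

Lemma dotS_sub_B n : dotS n \subset B n.
Proof. by rewrite gen_subG; apply/subsetP => _ /imsetP[i _ ->]; exact: cox_in_B. Qed.

Definition expgz (gT : finGroupType) (x : gT) (e : int) : gT :=
  match e with Posz a => x ^+ a | Negz a => x ^- a.+1 end.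

(* A word tau_{k_1}^{i_{k_1}} ... tau_{k_m}^{i_{k_m}} is encoded by the sequence of
   the pairs (k_j, i_{k_j}). *)
Definition word := seq (nat * int).

Definition word_val (n : nat) (w : word) : {perm spoint n} :=
  \prod_(t <- w) expgz (tau n t.1) t.2.

Definition gsOGS (n : nat) (p : {perm spoint n}) (w : word) : Prop :=
  [/\ sorted ltn [seq t.1 | t <- w],
      forall t, t \in w ->
        [/\ (1 <= t.1 <= n)%N, (- t.1%:Z <= t.2 < t.1%:Z)%R & t.2 <> 0%R]
    & p = word_val n w].

(* k_j and i_{k_j}, for 1 <= j <= m = size w *)
Definition idx (w : word) (j : nat) : nat := (nth (0%N, 0%R) w j.-1).1.
Definition ex (w : word) (j : nat) : int := (nth (0%N, 0%R) w j.-1).2.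

Definition cond1 (n : nat) (p : {perm spoint n}) (w : word) : Prop :=
  [/\ p = word_val n w,
      forall j, (1 <= j <= size w)%N ->
        (- (idx w j)%:Z <= ex w j <= (idx w j)%:Z - 1)%R
      (* the identity has the empty word, which has no first exponent *)
    & (0 < size w)%N -> (ex w 1 < 0)%R].

Definition cond2 (w : word) : Prop :=
  (\sum_(1 <= j < (size w).+1) ex w j = 0)%R.

Definition cond3 (w : word) : Prop :=
  forall r, (2 <= r <= size w)%N ->
    (0 <= \sum_(r <= j < (size w).+1) ex w j <= (idx w r.-1)%:Z)%R.

Definition cond3' (w : word) : Prop :=
  forall r, (1 <= r <= (size w).-1)%N ->
    (- (idx w r)%:Z <= \sum_(1 <= j < r.+1) ex w j <= 0)%R.

(* Main.v *)
(* The word is read off from right to left. After [tau_{k+1}^{i_{k+1}} ... tau_n^{i_n}]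
   has been cancelled on the right, the remaining permutation [rho] fixes all points
   beyond [k], and [i_k] is determined by [rho k], because the [2k] powers of [tau_k]
   send [k] to the [2k] points [1, ..., k, -1, ..., -k]; this gives uniqueness. If
   [rho_n] preserves signs then, with [T = i_{k+1} + ... + i_n], [rho] sends
   [{1, ..., k}] into the arc [{-1, ..., -T} U {T + 1, ..., k}] with [0 <= T <= k]:
   [tau_k^{-i}] rotates the arc, and the image of [k] is the one point which leaves it.
   The bounds on [T] are condition 3, and [T = 0] at [k = 0] is condition 2. *)

Require Import Defs.
From mathcomp Require Import all_boot all_order all_algebra all_fingroup.
From mathcomp Require Import zify.

Set Implicit Arguments.
Unset Strict Implicit.
Unset Printing Implicit Defensive.

Import GroupScope.

(* Hides the projection, so that [lia] identifies its occurrences whatever the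
   type at which the pair has been elaborated. *)
Definition pos n (x : spoint n) : nat := x.2.

Ltac if_lia :=
  repeat match goal with |- context [if ?b then _ else _] =>
    lazymatch b with context [if _ then _ else _] => fail | _ => destruct b eqn:? end
  end; lia.

(** * Action of the generators and of the powers of [tau] on points *)

Lemma spoint_eq n (x y : spoint n) : x.1 = y.1 -> pos x = pos y -> x = y.
Proof. by rewrite /pos; case: x y => [b i] [c j] /= -> /val_inj ->. Qed.

Lemma cox0E n (i : 'I_n) (x : spoint n) : i = 0 :> nat ->
  (cox i x).1 = x.1 (+) (pos x == 0) /\ pos (cox i x) = pos x.
Proof.
move=> i0; rewrite /cox i0 eqxx /pos; case: x => b j /=.
have -> : (j == 0 :> nat) = (j == i) by rewrite -val_eqE /= i0.
case: tpermP => [[-> ->]|[-> ->]|/eqP + /eqP]; rewrite ?eqxx //=.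
by rewrite !xpair_eqE /=; case: b; case: (j == i).
Qed.

Lemma coxSE n (i : 'I_n) (x : spoint n) : (0 < i)%N ->
  (cox i x).1 = x.1 /\
  pos (cox i x) = (if pos x == i then i.-1
                 else if pos x == i.-1 then i : nat else pos x).
Proof.
(* [ord_pred] is taken modulo [n]; for positive [i] nothing wraps. *)
move=> i_gt0; have pi : ord_pred i = i.-1 :> nat.
  by rewrite /= -subn1 -subn1 addnC -addnBA // modnDl modn_small; have := ltn_ord i; lia.
rewrite /cox ifN; last by rewrite -lt0n.
case: x => b j; rewrite permM /pos /= -pi.
move: (ord_pred i) pi => i' i'E.
have i'i : (i' == i) = false by apply/eqP => /(congr1 val); rewrite /= i'E; lia.
change (j == i :> nat) with (j == i); change (j == i' :> nat) with (j == i').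
case: b.
  rewrite (@tpermD _ (false, _)) //.
  case: tpermP => [[->]|[->]|/eqP + /eqP]; rewrite ?eqxx ?i'i //=.
  by rewrite !xpair_eqE /= => /negPf-> /negPf->.
case: (tpermP (false, i')) => [[->]|[->]|/eqP + /eqP].
- by rewrite tpermD ?i'i //= eqxx.
- by rewrite tpermD //= eqxx.
by rewrite tpermD // !xpair_eqE /= => /negPf-> /negPf->.
Qed.

Lemma tauE n k (kn : (k <= n)%N) : tau n k = \prod_(i < k) cox (widen_ord kn i).
Proof. by rewrite /tau (big_ord_narrow kn). Qed.

Lemma tauS n k (kn : (k < n)%N) : tau n k.+1 = tau n k * cox (Ordinal kn).
Proof.
rewrite (tauE kn) (tauE (ltnW kn)) big_ord_recr /=; congr (_ * cox _).
  by apply: eq_bigr => i _; congr cox; apply: val_inj.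
exact: val_inj.
Qed.

(** For k > 0 this is the 2k-cycle k -> k-1 -> ... -> 1 -> -k -> ... -> -1 -> k: the next generator
    moves the image of 1 from -k to -(k+1) and sends k+1 to k. *)
Lemma tau_act n k (x : spoint n) : (k <= n)%N ->
  (tau n k x).1 = x.1 (+) ((pos x == 0) && (0 < k)%N) /\
  pos (tau n k x) = (if pos x == 0 then k.-1
                   else if (pos x < k)%N then (pos x).-1 else pos x).
Proof.
elim: k => [|k IHk] kn.
  rewrite /tau big_pred0_eq perm1 andbF addbF; split=> //.
  by case: eqP.
have [e1 e2] := IHk (ltnW kn).
rewrite (tauS kn) permM; set y := tau n k x in e1 e2 *.
have [k0|k_gt0] := posnP k.
  have [-> ->] := cox0E y (k0 : Ordinal kn = 0 :> nat).
  by rewrite e1 {}e2 k0 /= andbF addbF andbT; case: (pos x).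
have [-> ->] := coxSE y (k_gt0 : (0 < Ordinal kn)%N).
rewrite e1 {}e2 k_gt0 /=; split=> //.
by if_lia.
Qed.

(** As [a <= k] is at most half the cycle length, a point wraps, and so changes sign, at most
    once. *)
Lemma tau_expg n k a (x : spoint n) : (k <= n)%N -> (a <= k)%N -> (pos x < k)%N ->
  ((tau n k ^+ a) x).1 = x.1 (+) (pos x < a)%N /\
  pos ((tau n k ^+ a) x) = (if (pos x < a)%N then pos x + k - a else pos x - a)%N.
Proof.
move=> kn; elim: a => [|a IHa] ak xk.
  by rewrite expg0 perm1 ltn0 addbF subn0.
have [e1 e2] := IHa (ltnW ak) xk.
rewrite expgSr permM; set y := (tau n k ^+ a) x in e1 e2 *.
have [-> ->] := tau_act y kn; rewrite e1 {}e2; split.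
  rewrite -addbA; congr (_ (+) _).
  by case: (ltngtP (pos x) a) => xa; if_lia.
by if_lia.
Qed.

Lemma tau_expVg n k a (x : spoint n) : (k <= n)%N -> (a <= k)%N -> (pos x < k)%N ->
  ((tau n k ^- a) x).1 = x.1 (+) (k <= pos x + a)%N /\
  pos ((tau n k ^- a) x) = (if (k <= pos x + a)%N then pos x + a - k else pos x + a)%N.
Proof.
move=> kn ak xk.
have yk : ((if k <= pos x + a then pos x + a - k else pos x + a) < k)%N by if_lia.
have yn := leq_trans yk kn.
(* [y] is the claimed image; the positive power brings it back to [x]. *)
pose y : spoint n := (x.1 (+) (k <= pos x + a)%N, Ordinal yn).
suff yx : (tau n k ^+ a) y = x by rewrite (canLR (permK _) (esym yx)).
have [e1 e2] := @tau_expg n k a y kn ak yk.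
have ey : pos y = if (k <= pos x + a)%N then (pos x + a - k)%N else (pos x + a)%N by [].
apply: spoint_eq; rewrite ?e1 ?e2 ey /=; clear -ak xk.
  rewrite -addbA -[RHS]addbF; congr (_ (+) _).
  by case: (leqP k (pos x + a)) => xa /=; lia.
by if_lia.
Qed.

Lemma tau_fix n k (x : spoint n) : (k <= n)%N -> (k <= pos x)%N -> tau n k x = x.
Proof.
move=> kn kx; have [e1 e2] := tau_act x kn; apply: spoint_eq; rewrite ?e1 ?e2.
  by rewrite (_ : _ && _ = false) ?addbF; lia.
by if_lia.
Qed.

Lemma expgz_fix (T : finType) (p : {perm T}) (e : int) x :
  p x = x -> expgz p e x = x.
Proof.
move=> px; have H a : (p ^+ a) x = x.
  by elim: a => [|a IHa]; rewrite ?expg0 ?perm1 // expgSr permM IHa.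
by case: e => a /=; rewrite ?H // -{1}(H a.+1) permK.
Qed.

Lemma expgz_in (gT : finGroupType) (G : {group gT}) (x : gT) (e : int) :
  x \in G -> expgz x e \in G.
Proof. by case: e => a xG /=; rewrite ?groupV groupX. Qed.

Lemma tau_in_B n k : tau n k \in B n.
Proof. by apply: group_prod => i _; exact: cox_in_B. Qed.

(** The point is k+1, the top of the cycle: nonnegative exponents move it down through positive
    points, negative ones wrap it at the first step up. Its image thus determines [e]. *)
Lemma tau_expgz_last n k e (kn : (k < n)%N) :
  (- k.+1%:Z <= e < k.+1%:Z)%R ->
  let y := expgz (tau n k.+1) e (false, Ordinal kn) in
  y.1 = (e < 0)%R /\ (if y.1 then e = - (pos y).+1%:Z else e = k%:Z - (pos y)%:Z)%R.
Proof.
pose z : spoint n := (false, Ordinal kn).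
case: e => a ak /=.
  have ak' : (a <= k.+1)%N by lia.
  have [-> ->] := tau_expg (x := z) kn ak' (ltnSn k).
  have -> : (pos z < a)%N = false by rewrite /pos /=; lia.
  by rewrite /pos /=; split; lia.
have ak' : (a.+1 <= k.+1)%N by lia.
have [-> ->] := tau_expVg (x := z) kn ak' (ltnSn k).
have -> : (k < pos z + a.+1)%N by rewrite /pos /=; lia.
by rewrite /pos /=; split; lia.
Qed.

(** * Words in the first [k] powers and uniqueness of the presentation *)

Definition wf_word (k : nat) (w : word) : Prop :=
  sorted ltn [seq t.1 | t <- w] /\
  forall t : nat * int, t \in w ->
    [/\ (1 <= t.1 <= k)%N, (- t.1%:Z <= t.2 < t.1%:Z)%R & t.2 <> 0%R].

(** Words omit trivial factors, while induction on [k] splits off one factor per step, possibly with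
    exponent 0. *)
Definition snoc (w : word) (k : nat) (e : int) : word :=
  if e == 0%R then w else rcons w (k, e).

Lemma gsOGS_wf n (p : {perm spoint n}) w :
  gsOGS p w <-> wf_word n w /\ p = word_val n w.
Proof. by split=> [[? ? ?]|[[? ?] ?]]. Qed.

Lemma word_val_rcons n w t :
  word_val n (rcons w t) = word_val n w * expgz (tau n t.1) t.2.
Proof. by rewrite /word_val big_rcons /=. Qed.

Lemma word_val_snoc n w k e :
  word_val n (snoc w k e) = word_val n w * expgz (tau n k) e.
Proof.
rewrite /snoc; case: eqP => [->|_]; last by rewrite word_val_rcons.
by rewrite /= expg0 mulg1.
Qed.

Lemma word_val_fix n k w (x : spoint n) : (k <= n)%N -> wf_word k w ->
  (k <= pos x)%N -> word_val n w x = x.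
Proof.
move=> kn [_ wk] kx; rewrite /word_val.
elim: w wk => [|t w IHw] wk; first by rewrite big_nil perm1.
rewrite big_cons permM expgz_fix; first by apply: IHw => u uw; apply: wk; rewrite inE uw orbT.
by have [? _ _] := wk t (mem_head _ _); apply: tau_fix; lia.
Qed.

Lemma sorted_fst_rcons (w : word) t :
  sorted ltn [seq u.1 | u <- rcons w t] =
  all (fun u : nat * int => u.1 < t.1)%N w && sorted ltn [seq u.1 | u <- w].
Proof.
by rewrite !(sorted_pairwise ltn_trans) map_rcons pairwise_rcons all_map.
Qed.

Lemma wf_word_le k l w : (k <= l)%N -> wf_word k w -> wf_word l w.
Proof. by move=> kl [? wk]; split=> // t /wk[? ? ?]; split=> //; lia. Qed.

Lemma wf_word_snoc k w e : wf_word k w -> (- k.+1%:Z <= e < k.+1%:Z)%R ->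
  wf_word k.+1 (snoc w k.+1 e).
Proof.
move=> wk ek; rewrite /snoc; case: eqP => [_|e0]; first exact: wf_word_le wk.
split.
  rewrite sorted_fst_rcons wk.1 andbT; apply/allP => u /wk.2[] /=; lia.
move=> t; rewrite mem_rcons inE => /predU1P[->|/wk.2[? ? ?]]; split=> //=; lia.
Qed.

Lemma wf_wordS k w : wf_word k.+1 w ->
  exists w' (e : int), [/\ wf_word k w', (- k.+1%:Z <= e < k.+1%:Z)%R & w = snoc w' k.+1 e].
Proof.
case/lastP: w => [|w [l e]] [sw wk].
  by exists [::], 0%R.
have [/= lk el e0] := wk (l, e) (ltac:(by rewrite mem_rcons mem_head)).
move: sw; rewrite sorted_fst_rcons => /andP[/allP /= wl sw].
have [kl|kl] := eqVneq l k.+1.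
  exists w, e; split; last by rewrite /snoc -kl; case: eqP.
    2: by rewrite -kl.
  split=> // t tw; have [? ? ?] := wk t (ltac:(by rewrite mem_rcons inE tw orbT)).
  by have tl : (t.1 < l)%N := wl t tw; split=> //; lia.
exists (rcons w (l, e)), 0%R; split=> //.
split; first by rewrite sorted_fst_rcons sw andbT; apply/allP.
move=> t tw; have [? ? ?] := wk t tw; split=> //.
have tl : (t.1 <= l)%N.
  by move: tw; rewrite mem_rcons inE => /predU1P[->|/wl /ltnW].
by move/eqP: kl; lia.
Qed.

Lemma word_val_inj n k w1 w2 : (k <= n)%N -> wf_word k w1 -> wf_word k w2 ->
  word_val n w1 = word_val n w2 -> w1 = w2.
Proof.
elim: k w1 w2 => [|k IHk] w1 w2 kn.
  have wf0 w : wf_word 0 w -> w = [::].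
    by case: w => // t w [_ /(_ t (mem_head _ _))[]]; lia.
  by move=> /wf0-> /wf0->.
move=> /wf_wordS[u1 [e1 [wf1 r1 ->]]] /wf_wordS[u2 [e2 [wf2 r2 ->]]].
rewrite !word_val_snoc => E.
suff Ee : e1 = e2.
  by move: E; rewrite Ee => /mulIg/IHk-> //; exact: ltnW.
(* Both left parts fix the point k+1, so its image depends on the last power alone. *)
have := congr1 (fun p : {perm _} => p (false, Ordinal kn)) E.
rewrite !permM (word_val_fix (ltnW kn) wf1) // (word_val_fix (ltnW kn) wf2) // => {}E.
have [_] := tau_expgz_last kn r1; have [_] := tau_expgz_last kn r2.
by rewrite E; case: ifP => _ h2 h1; apply: etrans h1 (esym h2).
Qed.

(** * Partial sums of exponents and existence of the presentation *)

Lemma idx_rcons w t j : (1 <= j <= size w)%N -> idx (rcons w t) j = idx w j.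
Proof. by case: j => // j /andP[_ jw]; rewrite /idx nth_rcons /= jw. Qed.

Lemma idx_last w t : idx (rcons w t) (size w).+1 = t.1.
Proof. by rewrite /idx nth_rcons ltnn eqxx. Qed.

Lemma sum_ex_split w r : (r <= size w)%N ->
  (\sum_(1 <= j < (size w).+1) ex w j =
   \sum_(1 <= j < r.+1) ex w j + \sum_(r.+1 <= j < (size w).+1) ex w j)%R.
Proof. by move=> rw; rewrite -big_cat_nat. Qed.

Lemma sum_ex_rcons w t r : (1 <= r <= (size w).+1)%N ->
  (\sum_(r <= j < (size (rcons w t)).+1) ex (rcons w t) j =
   \sum_(r <= j < (size w).+1) ex w j + t.2)%R.
Proof.
move=> rw; rewrite size_rcons big_nat_recr /=; last lia.
congr (_ + _)%R; last by rewrite /ex nth_rcons ltnn eqxx.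
apply: eq_big_nat => j /andP[rj jw]; rewrite /ex nth_rcons.
suff -> : (j.-1 < size w)%N by [].
by case: j rj jw => //; case: r rw.
Qed.

(* [T] is the sum of the exponents already split off on the right: the part
   of the product that remains sends [{1, ..., k}] into
   [{-1, ..., -T} U {T + 1, ..., k}]. *)
Lemma OGS_prefix n k (T : nat) (p : {perm spoint n}) :
    (T <= k <= n)%N -> p \in B n ->
    (forall x : spoint n, (k <= pos x)%N -> p x = x) ->
    (forall j, (p (false, j)).1 = (pos (p (false, j)) < T)%N) ->
  exists w, [/\ wf_word k w, p = word_val n w,
    (\sum_(1 <= j < (size w).+1) ex w j = - T%:Z)%R &
    forall r, (2 <= r <= (size w).+1)%N ->
      (0 <= T%:Z + \sum_(r <= j < (size w).+1) ex w j <= (idx w r.-1)%:Z)%R].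
Proof.
elim: k T p => [|k IHk] T p Tk pB pfix psgn.
  exists [::]; split=> //; last 2 first.
  - by rewrite big_geq //; lia.
  - by move=> r /=; lia.
  by rewrite /word_val big_nil; apply/permP => x; rewrite perm1 pfix.
have kn : (k < n)%N by lia.
pose z : spoint n := (false, Ordinal kn).
have p_lt (x : spoint n) : (pos x < k.+1)%N -> (pos (p x) < k.+1)%N.
  move=> xk; rewrite ltnNge; apply/negP => pxk.
  by move: xk; rewrite -(perm_inj (pfix _ pxk)); lia.
(* [e] is chosen so that the quotient fixes k+1; [T'] is the tail sum with [e] included. *)
suff [e [T' [ek Te Tk' qz qsgn]]] : exists (e : int) (T' : nat),
    [/\ (- k.+1%:Z <= e < k.+1%:Z)%R,
    (T'%:Z = T%:Z + e)%R, (T' <= k)%N, (p * (expgz (tau n k.+1) e)^-1) z = z &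
    forall j, let y := (p * (expgz (tau n k.+1) e)^-1) (false, j) in y.1 = (pos y < T')%N].
  set q := p * _ in qz qsgn.
  have qB : q \in B n by rewrite groupM // groupV expgz_in // tau_in_B.
  have qfix (x : spoint n) : (k <= pos x)%N -> q x = x.
    case: (ltngtP k (pos x)) => // [kx|xk] _.
      rewrite permM pfix //.
      by apply/(canLR (permK _)); rewrite expgz_fix // tau_fix.
    have [->|->] : x = z \/ x = sopp z.
      case: x xk => b j; rewrite /pos /= => kj.
      have -> : j = Ordinal kn by apply: val_inj.
      by case: b {kj}; [right | left].
    - exact: qz.
    - by move/signed_permsP: qB => ->; rewrite qz.
  have Tkn : (T' <= k <= n)%N by lia.
  have [w [wfw qw sw cw]] := IHk T' q Tkn qB qfix qsgn.
  exists (snoc w k.+1 e); split; first exact: wf_word_snoc.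
  - by rewrite word_val_snoc -qw mulgKV.
  - rewrite /snoc; case: eqP => [e0|_]; first by rewrite sw; lia.
    by rewrite sum_ex_rcons ?sw /=; lia.
  rewrite /snoc; case: eqP => [e0|_] r rw.
    by have := cw r rw; lia.
  (* Old boundaries follow by induction, as [T'] contains [e]. At the new one the remaining sum is
     empty and the bound is that on [T]. *)
  have [rw'|rw'] := leqP r (size w).+1.
    have := cw r; rewrite sum_ex_rcons; last lia.
    by rewrite idx_rcons /=; lia.
  have -> : r = (size w).+2 by move: rw; rewrite size_rcons; lia.
  rewrite idx_last /= big_geq ?size_rcons; lia.
have pz : (pos (p z) < k.+1)%N := p_lt z (ltnSn k).
have tau_fix_far e (y : spoint n) : (k < pos y)%N -> expgz (tau n k.+1) e y = y.
  by move=> ky; rewrite expgz_fix // tau_fix.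
have := psgn (Ordinal kn); rewrite -/z; set v := pos (p z) in pz *.
case: (ltnP v T) => [vT|Tv] sz.
(* k+1 goes to -(v+1), and v+1 steps down return it to k+1. They turn -1, ..., -(v+1) positive,
   which shortens the negative part by v+1. *)
- exists (Negz v), (T - v.+1)%N; split; try lia.
    rewrite permM /= invgK; have [e1 e2] := tau_expg (x := p z) kn pz pz.
    apply: spoint_eq; rewrite ?e1 ?e2 -/v ltnSn ?sz //.
    by rewrite -[pos z]/k; lia.
  move=> j; rewrite permM /= invgK; have := psgn j; set y := p _ => sy.
  have [yk|ky] := ltnP (pos y) k.+1.
    have [-> ->] := tau_expg (x := y) kn pz yk; rewrite sy.
    by case: (ltnP (pos y) v.+1) => ?; case: (ltnP (pos y) T) => ? /=; lia.
  by have /= -> := tau_fix_far (Posz v.+1) y ky; rewrite sy; lia.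
(* Now k+1 goes to v+1, and k-v steps up return it. The k-v positive points above v+1 wrap and
   become negative; [T <= v] gives [T' <= k]. *)
have ak : (k - v <= k.+1)%N by lia.
exists (Posz (k - v)), (T + (k - v))%N; split; try lia.
  rewrite permM /=; have [e1 e2] := tau_expVg (x := p z) kn ak pz.
  have vk : (k < v + (k - v))%N = false by lia.
  apply: spoint_eq; rewrite ?e1 ?e2 -/v vk ?sz //.
  by rewrite -[pos z]/k; lia.
move=> j; rewrite permM /=; have := psgn j; set y := p _ => sy.
have [yk|ky] := ltnP (pos y) k.+1.
  have [-> ->] := tau_expVg (x := y) kn ak yk; rewrite sy.
  by case: (ltnP k (pos y + (k - v))) => ?; case: (ltnP (pos y) T) => ? /=; lia.
suff -> : (tau n k.+1 ^- (k - v)) y = y by rewrite sy; lia.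
by apply/(canLR (permK _)); rewrite (tau_fix_far (Posz (k - v))).
Qed.

(** * The presentation on [dotS n] and the two forms of the bounds *)

Theorem theorem3p0p5 (n : nat) :
  (forall p : {perm spoint n}, p \in dotS n ->
     exists w : word,
       [/\ unique (gsOGS p) w, cond1 p w, cond2 w & cond3 w])
  /\ (forall w : word, cond2 w -> (cond3 w <-> cond3' w)).
Proof.
split=> [p pS|w w0]; last first.
  (* With total 0, the tail from r+1 is minus the head up to r. *)
  have split_sum r (rw : (r <= size w)%N) := etrans (esym (sum_ex_split rw)) w0.
  split=> H [|r] rw //.
    have rw' : (2 <= r.+2 <= size w)%N by lia.
    have := H _ rw'; have := split_sum r.+1 (ltac:(lia)).
    by rewrite [r.+2.-1]/=; lia.
  have rw' : (1 <= r <= (size w).-1)%N by lia.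
  have := H _ rw'; have := split_sum r (ltac:(lia)).
  by rewrite [r.+1.-1]/=; lia.
have p1 (x : spoint n) : (p x).1 = x.1.
  (* The stabilizer of the set of negative points is a group containing the generators of
     [dotS n]. *)
  have : p \in 'N([set y : spoint n | y.1] | 'P).
    apply: subsetP pS; rewrite gen_subG; apply/subsetP => _ /imsetP[i i0 ->].
    rewrite inE in i0; apply/astabsP => y.
    by rewrite /= apermE !inE (coxSE y i0).1.
  by move=> /astabsP/(_ x); rewrite /= apermE !inE.
have nn : (0 <= n <= n)%N by lia.
have [x|j|w [wfw pw sw cw]] := OGS_prefix nn (subsetP (dotS_sub_B n) p pS).
- by move=> nx; have := leq_ltn_trans nx (ltn_ord x.2); rewrite ltnn.
- by rewrite p1 ltn0.
have wE j : (1 <= j <= size w)%N ->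
    (- (idx w j)%:Z <= ex w j < (idx w j)%:Z)%R /\ ex w j <> 0%R.
  by case: j => // j jw; have [] := wfw.2 _ (mem_nth (0%N, 0%R) jw).
exists w; split.
- split; first by apply/gsOGS_wf.
  by move=> w' /gsOGS_wf[wfw' pw']; apply: (word_val_inj (leqnn n)); rewrite -?pw.
- split=> // [j /wE[+ _]|w_gt0]; first by lia.
  (* The tail from 2 is nonnegative and the total is 0, so the first exponent is at most 0; it is
     also nonzero. *)
  have [_] := wE 1%N w_gt0; have := cw 2%N w_gt0.
  by move: sw; rewrite (sum_ex_split w_gt0) big_nat1; lia.
- by rewrite /cond2 sw.
- by move=> r rw; have := cw r; lia.
Qed.
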